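(* There is an absolute constant $C$ such that for every finite connected simple graph $G=(V,E)$ with $n$ vertices, minimum degree $\delta$ and maximum degree $\Delta$, and every choice of rotor sequence lengths with parameter $\tilde\kappa$, \[ \widetilde{\mathsf{EC}}(G)\le C\Big(\frac{\Delta}{\delta}\max_{u,v\in V}\mathsf{H}(u,v)+\Delta\, n\,\tilde\kappa+\tilde\kappa\,\Delta\max_{s\in V}\sum_{\{i,j\}\in E}|f_s(i,j)|\Big). \]
   Context: $\mathsf{H}(u,v)$ is the expected hitting time of $v$ from $u$ for the simple random walk ($\mathbf{P}_{u,v}=1/\deg(u)$ on edges). For $s\in V$, $f_s$ is the flow on $G$ (antisymmetric: $f_s(i,j)=-f_s(j,i)$, supported on edges) in which the source $s$ sends one unit of flow to every other vertex (i.e. net outflow $n-1$ at $s$ and net inflow $1$ at every other vertex) and which minimizes $\sum_{\{i,j\}\in E}f_s(i,j)^2$ among all such flows. Unweighted deterministic walk: each vertex $u$ has a rotor sequence of length $\tilde d(u)$ of neighbours of $u$, each occurring exactly $\tilde d(u)/\deg(u)$ times, and an initial rotor position; $\tilde\kappa=\max_u\tilde d(u)/\deg(u)$. The walk moves from the current vertex to the vertex its rotor points at and then advances that rotor cyclically. $\widetilde{\mathsf{EC}}(G)$ is the maximum over start vertices and all rotor sequences/initial positions (lengths fixed) of the first time at which every edge has been traversed. *)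

(* Defs.v *)
From HB Require Import structures.
From mathcomp Require Import all_boot all_order all_algebra.
From mathcomp Require Import all_classical all_reals all_analysis.

Set Implicit Arguments.
Unset Strict Implicit.
Unset Printing Implicit Defensive.
Import Order.TTheory GRing.Theory Num.Theory.
Local Open Scope classical_set_scope.
Local Open Scope ring_scope.

(* A simple graph is a symmetric irreflexive relation on a finite type. *)
Definition connected_simple_graph (V : finType) (e : rel V) : Prop :=
  [/\ symmetric e, irreflexive e, (0 < #|V|)%N & forall u v : V, connect e u v].

Definition deg (V : finType) (e : rel V) (u : V) : nat := #|[set v | e u v]%SET|.

Definition max_degree (V : finType) (e : rel V) : nat := (\max_(u : V) deg e u)%N.

(* The default value #|V| is larger than every degree of a simple graph. *)
Definition min_degree (V : finType) (e : rel V) : nat :=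
  \big[minn/#|V|]_(u : V) deg e u.

Section RandomWalk.
Variables (R : realType) (V : finType) (e : rel V).

Definition srw (u v : V) : R := if e u v then ((deg e u)%:R)^-1 else 0.

(* Probability that the walk with X_0 = u satisfies (X_1, ..., X_t) = p. *)
Fixpoint trajectory_prob (u : V) (p : seq V) : R :=
  if p is v :: p' then srw u v * trajectory_prob v p' else 1.

(* P_u(T_v = t) with T_v = min {t >= 0 : X_t = v}: for p = (X_1, ..., X_t),
   last u p is X_t and belast u p is (X_0, ..., X_{t-1}). *)
Definition first_hit_prob (u v : V) (t : nat) : R :=
  \sum_(p : t.-tuple V | (last u p == v) && (v \notin belast u p))
    trajectory_prob u p.

(* E_u[T_v] for the extended random variable T_v; the second summand is the
   contribution of the event T_v = +oo (recall +oo * 0 = 0). *)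
Definition hitting_time (u v : V) : \bar R :=
  (\sum_(0 <= t <oo) (t%:R * first_hit_prob u v t)%:E
   + +oo * (1 - \sum_(0 <= t <oo) (first_hit_prob u v t)%:E))%E.

Definition max_hitting_time : \bar R :=
  \big[maxe/-oo%E]_(u : V) \big[maxe/-oo%E]_(v : V) hitting_time u v.

End RandomWalk.

Section Flow.
Variables (R : realType) (V : finType) (e : rel V).

(* Sum over the unordered edges {i,j} of a quantity symmetric in i and j: every
   edge is met twice by the sum over ordered pairs. *)
Definition edge_sum (F : V -> V -> R) : R :=
  2^-1 * \sum_(i : V) \sum_(j : V | e i j) F i j.

Definition source_flow (s : V) (f : V -> V -> R) : Prop :=
  [/\ forall i j, f i j = - f j i,
      forall i j, ~~ e i j -> f i j = 0 &
      forall i, \sum_(j : V) f i j = if i == s then (#|V|.-1)%:R else -1].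

Definition optimal_source_flow (s : V) (f : V -> V -> R) : Prop :=
  source_flow s f /\
  forall g, source_flow s g ->
    edge_sum (fun i j => f i j ^+ 2) <= edge_sum (fun i j => g i j ^+ 2).

Definition max_flow_norm1 (f : V -> V -> V -> R) : R :=
  \big[Num.max/0]_(s : V) edge_sum (fun i j => `|f s i j|).

End Flow.

Section RotorWalk.
Variables (V : finType) (e : rel V).

(* No graph with an isolated vertex admits rotor lengths. *)
Definition rotor_lengths (d : V -> nat) : Prop :=
  forall u, (0 < d u)%N /\ (deg e u %| d u)%N.

Definition kappa (d : V -> nat) : nat := (\max_(u : V) d u %/ deg e u)%N.

Definition rotor_sequences (d : V -> nat) (rho : V -> seq V) : Prop :=
  forall u, size (rho u) = d u /\
    forall v, count_mem v (rho u) = if e u v then (d u %/ deg e u)%N else 0%N.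

Definition rotor_positions (d : V -> nat) (pos : V -> nat) : Prop :=
  forall u, (pos u < d u)%N.

Definition rotor_step (rho : V -> seq V) (st : V * (V -> nat)) :
    V * (V -> nat) :=
  let: (x, pos) := st in
  (nth x (rho x) (pos x),
   fun y => if y == x then ((pos x).+1 %% size (rho x))%N else pos y).

Definition rotor_walk (rho : V -> seq V) (pos : V -> nat) (x : V) (t : nat) : V :=
  (iter t (rotor_step rho) (x, pos)).1.

(* Every (undirected) edge is traversed, in one direction at least, during the
   first t steps of the walk w. *)
Definition edges_covered (w : nat -> V) (t : nat) : Prop :=
  forall i j, e i j -> exists2 k, (k < t)%N &
    (w k = i /\ w k.+1 = j) \/ (w k = j /\ w k.+1 = i).

Definition edge_cover_time_from (R : realType) (w : nat -> V) : \bar R :=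
  ereal_inf [set (t%:R)%:E | t in [set t : nat | edges_covered w t]].

Definition rotor_edge_cover_time (R : realType) (d : V -> nat) : \bar R :=
  ereal_sup [set c : \bar R | exists x rho pos,
    [/\ rotor_sequences d rho, rotor_positions d pos &
        c = edge_cover_time_from R (rotor_walk rho pos x)]].

End RotorWalk.

(* Main.v *)
Require Import Defs.
From HB Require Import structures.
From mathcomp Require Import all_boot all_order all_algebra.
From mathcomp Require Import all_classical all_reals all_analysis.
From mathcomp Require Import lra ring.

Set Implicit Arguments.
Unset Strict Implicit.
Unset Printing Implicit Defensive.
Import Order.TTheory GRing.Theory Num.Theory.
Local Open Scope ring_scope.

(* The optimal flow f_s is the gradient of a potential g with g(s) = 0 whose
   Laplacian is 1 off s and -(n-1) at s, and g >= 0 by the minimum principle.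
   Optional stopping for g along the simple random walk gives
   delta * g(u) <= H(u,s).  Let N(u) and N(u,v) count the departures from u and
   the traversals of (u,v) in t steps of the rotor walk, and let
   y(u) = N(u)/deg(u).  The sum of N(u,v) (g(u) - g(v)) telescopes along the
   walk, and |y(u) - N(u,v)| <= kappa, so pairing y with the Laplacian of g gives
     sum_u y(u) <= n y(s) + g(w_0) - g(w_t) + 2 kappa sum_{ij} |f_s(i,j)|.
   If the edge {s,j} is not yet covered then N(s,j) = 0, hence y(s) <= kappa,
   while t <= Delta * sum_u y(u). *)

Definition laplacian (R : realType) (V : finType) (e : rel V) (g : V -> R)
  (u : V) : R := \sum_(v | e u v) (g u - g v).

(** * Degree bounds *)

Section Degrees.
Variables (V : finType) (e : rel V).

Lemma deg_le_max_degree u : (deg e u <= max_degree e)%N.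
Proof. exact: leq_bigmax. Qed.

Lemma min_degree_le_deg u : (min_degree e <= deg e u)%N.
Proof.
rewrite /min_degree; have: u \in index_enum V by rewrite mem_index_enum.
elim: index_enum => // a r IH; rewrite inE big_cons => /orP [/eqP <-|/IH].
  exact: geq_minl.
by apply: leq_trans; exact: geq_minr.
Qed.

Lemma min_degree_gt0 :
  (0 < #|V|)%N -> (forall u, 0 < deg e u)%N -> (0 < min_degree e)%N.
Proof.
move=> V0 d0; rewrite /min_degree.
by elim/big_ind: _ => // a b a0 b0; rewrite leq_min a0.
Qed.

Lemma rotor_lengths_deg_gt0 d u : rotor_lengths e d -> (0 < deg e u)%N.
Proof. by move=> /(_ u) [du /dvdn_gt0]; apply. Qed.

Lemma sum_neighbours (R : realType) u (c : R) :
  \sum_(v | e u v) c = (deg e u)%:R * c.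
Proof. by rewrite sumr_const mulr_natl /deg cardsE. Qed.

End Degrees.

(** * The graph Laplacian, the potential of a source flow, and Thomson's principle *)

Section Potential.
Variables (R : realType) (V : finType) (e : rel V).
Hypothesis esym : symmetric e.

Lemma exchange_neighbours (F : V -> V -> R) :
  \sum_u \sum_(v | e u v) F u v = \sum_u \sum_(v | e u v) F v u.
Proof.
rewrite (exchange_big_dep xpredT) //=.
by apply: eq_bigr => v _; apply: eq_bigl => u; rewrite esym.
Qed.

(** Summation by parts: adding the sum to its copy with the endpoints exchanged symmetrises it,
    which is where the factor 2 comes from. *)
Lemma laplacian_green (g h : V -> R) :
  2 * \sum_u h u * laplacian e g u =
  \sum_u \sum_(v | e u v) (h u - h v) * (g u - g v).
Proof.
have -> : \sum_u h u * laplacian e g u =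
    \sum_u \sum_(v | e u v) h u * (g u - g v).
  by apply: eq_bigr => u _; rewrite mulr_sumr.
rewrite mulr_natl mulr2n {2}exchange_neighbours -big_split /=.
apply: eq_bigr => u _; rewrite -big_split /=; apply: eq_bigr => v _.
by ring.
Qed.

Lemma sum_laplacian (g : V -> R) : \sum_u laplacian e g u = 0.
Proof.
have := laplacian_green g (fun=> 1).
rewrite [RHS]big1 => [|u _]; last by rewrite big1 // => v _; rewrite subrr mul0r.
under eq_bigr do rewrite mul1r.
by move=> /eqP; rewrite mulf_eq0 pnatr_eq0 /= => /eqP.
Qed.

(** Pairing the equation with [g] itself makes the Dirichlet energy plus [2 * g s ^+ 2] vanish.
    Hence [g s = 0] and [g] is constant along edges, so connectedness carries 0 everywhere. *)
Lemma grounded_laplacian_eq0 (g : V -> R) s :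
  (forall u v, connect e u v) ->
  (forall u, laplacian e g u + (u == s)%:R * g s = 0) -> forall u, g u = 0.
Proof.
move=> econn Lg.
have /eqP : \sum_u \sum_(v | e u v) (g u - g v) ^+ 2 + 2 * g s ^+ 2 = 0.
  under eq_bigr do under eq_bigr do rewrite expr2.
  rewrite -laplacian_green -mulrDr.
  rewrite (_ : g s ^+ 2 = \sum_u g u * ((u == s)%:R * g s)).
    rewrite -big_split /= big1 ?mulr0 // => u _.
    by rewrite -mulrDr Lg mulr0.
  rewrite (bigD1 s) //= eqxx mul1r big1 ?addr0 ?expr2 // => u /negPf ->.
  by rewrite mul0r mulr0.
have ge0 u : 0 <= \sum_(v | e u v) (g u - g v) ^+ 2.
  by apply: sumr_ge0 => v _; exact: sqr_ge0.
rewrite paddr_eq0; [|exact: sumr_ge0|by rewrite pmulr_rge0 // sqr_ge0].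
rewrite mulf_eq0 pnatr_eq0 sqrf_eq0 /= => /andP [/eqP gE /eqP gs0].
have gedge u v : e u v -> g u = g v.
  move=> euv.
  have := @psumr_eq0P _ _ xpredT _ (fun i _ => ge0 i) gE u isT.
  move=> /(psumr_eq0P (fun i _ => sqr_ge0 _)) /(_ v euv) /eqP.
  by rewrite sqrf_eq0 subr_eq0 => /eqP.
move=> u; rewrite -gs0; have /connectP [p pth ->] := econn u s.
elim: p u pth => //= a p IH u /andP [/gedge -> /IH]; exact.
Qed.

(** The Laplacian is singular because it kills constants. Adding [g s] in row [s] makes it
    invertible, and the solution of the modified system turns out to solve the original one. *)
Lemma source_potential_exists s :
  (forall u v, connect e u v) -> exists g : V -> R, g s = 0 /\
  forall u, laplacian e g u = if u == s then - (#|V|.-1)%:R else 1.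
Proof.
move=> econn.
pose b u : R := if u == s then - (#|V|.-1)%:R else 1.
pose vec (g : V -> R) : 'cV[R]_#|V| := \col_i g (enum_val i).
pose A : 'M[R]_#|V| := \matrix_(i, j)
  ((if i == j then (deg e (enum_val i))%:R + (enum_val i == s)%:R else 0)
    - (e (enum_val i) (enum_val j))%:R).
have AE (x : 'cV[R]_#|V|) i : (A *m x) i 0 =
    laplacian e (fun v => x (enum_rank v) 0) (enum_val i)
    + (enum_val i == s)%:R * x (enum_rank s) 0.
  rewrite mxE; under eq_bigr do rewrite mxE mulrBl.
  rewrite sumrB (bigD1 i) //= eqxx [X in _ + X - _]big1 ?addr0; last first.
    by move=> j; rewrite eq_sym => /negPf ->; rewrite mul0r.
  rewrite /laplacian sumrB sum_neighbours enum_valK mulrDl -!addrA; congr +%R.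
  rewrite [LHS]addrC; congr (- _ + _).
    rewrite [RHS]big_mkcond (reindex (@enum_val _ V)) /=; last first.
      exact/onW_bij/enum_val_bij.
    apply: eq_bigr => j _; rewrite enum_valK.
    by case: (e _ _); rewrite ?mul1r ?mul0r.
  by case: eqP => [<-|]; rewrite ?mul0r // enum_valK.
(* Each row of the kernel matrix of the transpose is a vector killed by [A], hence zero by
   [grounded_laplacian_eq0]. *)
have Aunit : A \in unitmx.
  rewrite -unitmx_tr -row_free_unit -kermx_eq0; apply/eqP/row_matrixP => k.
  rewrite row0; set r := row k _.
  have rA : A *m r^T = 0.
    apply: (can_inj (@trmxK _ _ _)); rewrite trmx_mul trmxK trmx0.
    by apply/sub_kermxP; exact: row_sub.
  have r0 v : r^T (enum_rank v) 0 = 0.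
    apply: (@grounded_laplacian_eq0 (fun v => r^T (enum_rank v) 0) s) => // u.
    by have := AE r^T (enum_rank u); rewrite rA mxE enum_rankK => <-.
  by apply/rowP => j; have := r0 (enum_val j); rewrite enum_valK !mxE.
pose g v : R := (invmx A *m vec b) (enum_rank v) 0.
have Lg u : laplacian e g u + (u == s)%:R * g s = b u.
  have := AE (invmx A *m vec b) (enum_rank u).
  by rewrite mulKVmx // mxE enum_rankK => ->.
(* Summed over all vertices, both the Laplacian and [b] give 0, so only the grounding term [g s] is
   left. *)
have gs0 : g s = 0.
  have : \sum_u (laplacian e g u + (u == s)%:R * g s) = \sum_u b u.
    by apply: eq_bigr => u _; rewrite Lg.
  rewrite big_split /= sum_laplacian add0r (bigD1 s) //= eqxx mul1r.
  rewrite big1 ?addr0 => [->|u /negPf -> ]; last by rewrite mul0r.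
  rewrite (bigD1 s) //= {1}/b eqxx (eq_bigr (fun=> 1)).
    rewrite sumr_const (_ : #|_| = #|V|.-1) ?addNr //.
    rewrite -(cardC1 s); exact: eq_card.
  by move=> u /negPf; rewrite /b => ->.
exists g; split=> // u.
by rewrite -[LHS]addr0 -(mulr0 (u == s)%:R) -gs0 Lg.
Qed.

(** Minimum principle: the Laplacian is at most 0 at a minimiser, so the minimum can only be
    attained at [s]. *)
Lemma source_potential_ge0 (g : V -> R) s : g s = 0 ->
  (forall u, u != s -> 0 < laplacian e g u) -> forall u, 0 <= g u.
Proof.
move=> gs0 Lg; pose m := [arg min_(v < s) g v]%O.
have gm v : g m <= g v by rewrite /m; case: arg_minP => // i _ /(_ v); apply.
move=> u; apply: le_trans (gm u); rewrite -gs0.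
have [->//|/Lg] := eqVneq m s.
rewrite ltNge => /negP[]; apply: sumr_le0 => v _.
by rewrite subr_le0.
Qed.

(** The gradient [h] of [g] is an admissible flow. The difference [r] between [f] and [h] is a
    circulation, hence orthogonal to gradients, so the energy of [f] is that of [h] plus that of
    [r], and optimality forces [r = 0]. *)
Lemma optimal_source_flowE s (f : V -> V -> R) (g : V -> R) :
  optimal_source_flow e s f ->
  (forall u, laplacian e g u = if u == s then - (#|V|.-1)%:R else 1) ->
  forall i j, e i j -> f i j = g j - g i.
Proof.
move=> [[fanti fsupp fdiv] fopt] Lg.
pose h i j := if e i j then g j - g i else 0.
have hflow : source_flow e s h.
  split=> [i j|i j /negPf|i]; rewrite /h.
  - by rewrite esym; case: (e j i); rewrite ?oppr0 ?opprB.
  - by move->.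
  - rewrite -big_mkcond /=.
    have -> : \sum_(j | e i j) (g j - g i) = - laplacian e g i.
      by rewrite -sumrN; apply: eq_bigr => v _; rewrite opprB.
    by rewrite Lg; case: eqP => _; rewrite ?opprK.
pose r i j := f i j - h i j.
have rdiv i : \sum_(j | e i j) r i j = 0.
  have [_ _ hdiv] := hflow.
  rewrite big_mkcond (eq_bigr (r i)) => [|j _].
    by rewrite sumrB fdiv hdiv subrr.
  by case: ifPn => // nij; rewrite /r /h fsupp // (negPf nij) subrr.
have ranti i j : r i j = - r j i.
  by have [hanti _ _] := hflow; rewrite /r fanti hanti opprD !opprK.
have cross : \sum_i \sum_(j | e i j) h i j * r i j = 0.
  have gr : \sum_i \sum_(j | e i j) g i * r i j = 0.
    by rewrite big1 // => i _; rewrite -mulr_sumr rdiv mulr0.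
  (* By antisymmetry of [r], the two endpoints of [g j - g i] contribute equally. *)
  transitivity (- 2 * \sum_i \sum_(j | e i j) g i * r i j); last first.
    by rewrite gr mulr0.
  rewrite mulNr mulr_natl mulr2n {1}(exchange_neighbours (fun i j => g i * r i j)) opprD -!sumrN.
  rewrite -big_split /=; apply: eq_bigr => i _.
  rewrite -!sumrN -big_split /=; apply: eq_bigr => j eij.
  have -> : h i j = g j - g i by rewrite /h eij.
  rewrite (ranti j i); ring.
have := fopt _ hflow; rewrite /edge_sum ler_pM2l ?invr_gt0 //.
have -> : \sum_i \sum_(j | e i j) f i j ^+ 2 =
   \sum_i \sum_(j | e i j) h i j ^+ 2 + 2 * \sum_i \sum_(j | e i j) h i j * r i j
   + \sum_i \sum_(j | e i j) r i j ^+ 2.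
  rewrite mulr_sumr -!big_split /=; apply: eq_bigr => i _.
  rewrite mulr_sumr -!big_split /=; apply: eq_bigr => j _.
  rewrite /r; ring.
rewrite cross mulr0 addr0 gerDl => rle.
have rge i : 0 <= \sum_(j | e i j) r i j ^+ 2.
  by apply: sumr_ge0 => j _; exact: sqr_ge0.
have rE : \sum_i \sum_(j | e i j) r i j ^+ 2 = 0.
  by apply/eqP; rewrite eq_le rle sumr_ge0.
move=> i j eij.
have := @psumr_eq0P _ _ xpredT _ (fun i _ => rge i) rE i isT.
move=> /(psumr_eq0P (fun i _ => sqr_ge0 _)) /(_ j eij) /eqP.
by rewrite sqrf_eq0 subr_eq0 /h eij => /eqP.
Qed.

End Potential.

(** * Counting occurrences in a cyclically read sequence *)

Section CyclicCount.
Local Open Scope nat_scope.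

Lemma sum_periodic_window (F : nat -> nat) d a :
  (forall k, F (k + d) = F k) -> \sum_(m < d) F (a + m) = \sum_(m < d) F m.
Proof.
move=> Fd; elim: a => [//|a <-]; case: d Fd => [|d] Fd; first by rewrite !big_ord0.
rewrite big_ord_recr [RHS]big_ord_recl /= addn0 addnC addSnnS Fd.
by congr (_ + _); apply: eq_bigr => i _; rewrite addSnnS.
Qed.

(** Partial sums are monotone, and [n] lies between two consecutive multiples of [d], at which the
    sum is a whole number of periods wherever the window starts. *)
Lemma sum_periodic_bounds (F : nat -> nat) d p n :
  0 < d -> (forall k, F (k + d) = F k) ->
  n %/ d * \sum_(m < d) F m <= \sum_(m < n) F (p + m)
    <= (n %/ d).+1 * \sum_(m < d) F m.
Proof.
move=> d0 Fd; set c := \sum_(m < d) F m.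
pose S k := \sum_(m < k) F (p + m).
have Smono k l : k <= l -> S k <= S l.
  move=> /subnKC <-; rewrite /S big_split_ord /=; exact: leq_addr.
have Sq q : S (q * d) = q * c.
  elim: q => [|q IH]; first by rewrite !mul0n /S big_ord0.
  rewrite mulSn addnC /S big_split_ord /= -/(S _) IH mulSn addnC; congr (_ + _).
  by under eq_bigr do rewrite addnA; rewrite sum_periodic_window.
by rewrite -!Sq !Smono // ?leq_divM // ltnW // ltn_ceil.
Qed.

Lemma sum_nth_count (T : eqType) (x0 v : T) (s : seq T) :
  \sum_(m < size s) (nth x0 s m == v) = count_mem v s.
Proof.
elim: s => [|a s IH] /=; first by rewrite big_ord0.
by rewrite big_ord_recl /= IH.
Qed.

Lemma cyclic_count_bounds (T : eqType) (x0 v : T) (s : seq T) p n :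
  0 < size s ->
  n %/ size s * count_mem v s
    <= \sum_(m < n) (nth x0 s ((p + m) %% size s) == v)
    <= (n %/ size s).+1 * count_mem v s.
Proof.
move=> s0; rewrite -(sum_nth_count x0).
have := @sum_periodic_bounds (fun k => nth x0 s (k %% size s) == v) _ p n s0.
have -> : \sum_(m < size s) (nth x0 s (m %% size s) == v) =
    \sum_(m < size s) (nth x0 s m == v).
  by apply: eq_bigr => m _; rewrite modn_small.
by apply => k; rewrite modnDr.
Qed.

End CyclicCount.

(** * Departures and traversals of the rotor walk *)

Section Rotor.
Variable V : finType.

(** Time [t] is excluded, so every visit counted is followed by a departure within the [t] steps. *)
Definition visits (w : nat -> V) t u := (\sum_(k < t) (w k == u))%N.
Definition crossings (w : nat -> V) t u v :=
  (\sum_(k < t) ((w k == u) && (w k.+1 == v)))%N.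

Lemma sum_visits w t : (\sum_u visits w t u = t)%N.
Proof.
rewrite /visits exchange_big /= -[RHS]card_ord -sum1_card.
apply: eq_bigr => k _; rewrite (bigD1 (w k)) //= eqxx big1 ?addn0 // => u.
by rewrite eq_sym => /negPf ->.
Qed.

Lemma visitsS w t u : (visits w t.+1 u = visits w t u + (w t == u))%N.
Proof. by rewrite /visits big_ord_recr. Qed.

Lemma crossingsS w t u v : (crossings w t.+1 u v =
  crossings w t u v + ((w t == u) && (w t.+1 == v)))%N.
Proof. by rewrite /crossings big_ord_recr. Qed.

Variables (e : rel V) (d : V -> nat) (rho : V -> seq V) (pos : V -> nat) (x : V).
Hypotheses (dlen : rotor_lengths e d) (rhoP : rotor_sequences e d rho)
  (posP : rotor_positions d pos).
Let w := rotor_walk rho pos x.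

Lemma size_rotor u : size (rho u) = d u. Proof. by case: (rhoP u). Qed.

Lemma rotor_positionE t y :
  (iter t (rotor_step rho) (x, pos)).2 y = ((pos y + visits w t y) %% d y)%N.
Proof.
elim: t => [|t IH]; first by rewrite /visits big_ord0 addn0 modn_small.
have := IH; rewrite iterS visitsS.
have -> : w t = (iter t (rotor_step rho) (x, pos)).1 by [].
case: (iter t _ _) => z q /=; rewrite [z == y]eq_sym size_rotor.
case: eqP => [<- ->|_ ->]; last by rewrite addn0.
by rewrite addn1 addnS -[in LHS]addn1 modnDml addn1.
Qed.

Lemma rotor_walkS t : w t.+1 =
  nth (w t) (rho (w t)) ((pos (w t) + visits w t (w t)) %% d (w t)).
Proof.
have := rotor_positionE t (w t).
have -> : w t.+1 = (rotor_step rho (iter t (rotor_step rho) (x, pos))).1 by [].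
have -> : w t = (iter t (rotor_step rho) (x, pos)).1 by [].
by case: (iter t _ _) => z q /= ->.
Qed.

Lemma rotor_walk_edge t : e (w t) (w t.+1).
Proof.
have [sz cnt] := rhoP (w t); have [d0 _] := dlen (w t).
have : w t.+1 \in rho (w t) by rewrite rotor_walkS mem_nth // sz ltn_mod.
by rewrite -has_pred1 has_count cnt; case: (e _ _).
Qed.

(** Successive departures from [u] read the rotor sequence of [u] cyclically from [pos u], so the
    traversals of [(u, v)] depend on the walk only through the number of departures. *)
Lemma crossingsE t u v : crossings w t u v =
  (\sum_(m < visits w t u) (nth u (rho u) ((pos u + m) %% d u) == v))%N.
Proof.
elim: t => [|t IH]; first by rewrite /crossings /visits !big_ord0.
have wS := rotor_walkS t.
rewrite crossingsS visitsS IH.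
case: eqP => [wu|_] /=; last by rewrite !addn0.
by rewrite addn1 big_ord_recr /= wS wu.
Qed.

(** With [q] complete turns of the rotor at [u] and [k] copies of [v] per turn, both quantities lie
    between [q * k] and [q.+1 * k]. *)
Lemma rotor_discrepancy (R : realType) t u v : e u v ->
  `|(visits w t u)%:R / (deg e u)%:R - (crossings w t u v)%:R| <= (kappa e d)%:R :> R.
Proof.
move=> euv; have [d0 dvd] := dlen u; have [sz cnt] := rhoP u.
have g0 : (0 < deg e u)%N := rotor_lengths_deg_gt0 u dlen.
have := cnt v; rewrite euv => cv.
have := @cyclic_count_bounds _ u v (rho u) (pos u) (visits w t u).
rewrite sz cv -crossingsE => /(_ d0).
set c := crossings _ _ _ _; set n := visits _ _ _; set k := (d u %/ deg e u)%N.
set q := (n %/ d u)%N => /andP [lo hi].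
have kk : (k <= kappa e d)%N by apply: (leq_bigmax u).
have dk : d u = (k * deg e u)%N by rewrite /k divnK.
have g0R : 0 < (deg e u)%:R :> R by rewrite ltr0n.
apply: (@le_trans _ _ (k%:R)); last by rewrite ler_nat.
have nlo : q%:R * k%:R <= n%:R / (deg e u)%:R :> R.
  by rewrite ler_pdivlMr // -!natrM ler_nat -mulnA -dk leq_divM.
have nhi : n%:R / (deg e u)%:R <= (q.+1)%:R * k%:R :> R.
  by rewrite ler_pdivrMr // -!natrM ler_nat -mulnA -dk ltnW // ltn_ceil.
have clo : q%:R * k%:R <= c%:R :> R by rewrite -natrM ler_nat.
have chi : c%:R <= (q.+1)%:R * k%:R :> R by rewrite -natrM ler_nat.
rewrite -natr1 mulrDl mul1r in nhi chi.
rewrite ler_norml; apply/andP; split; lra.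
Qed.

Lemma sum_crossings (R : realType) (g : V -> R) t :
  \sum_u \sum_(v | e u v) (crossings w t u v)%:R * (g u - g v) = g (w 0%N) - g (w t).
Proof.
elim: t => [|t IH].
  rewrite subrr big1 // => u _; rewrite big1 // => v _.
  by rewrite /crossings big_ord0 mul0r.
rewrite -[RHS](subrKA (g (w t))) -IH; under eq_bigr => u _.
  under eq_bigr => v _.
    rewrite crossingsS natrD mulrDl; over.
  rewrite big_split /=; over.
rewrite big_split /=; congr (_ + _).
(* Only the pair [(w t, w t.+1)] gains a crossing, and [rotor_walk_edge] puts it in the range of the
   sum. *)
rewrite (bigD1 (w t)) //= [X in _ + X]big1 ?addr0; last first.
  by move=> u; rewrite eq_sym => /negPf wu; rewrite big1 // => v _; rewrite wu mul0r.
rewrite (bigD1 (w t.+1)) ?rotor_walk_edge //= !eqxx mul1r big1 ?addr0 // => v.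
by rewrite eq_sym => /andP [_ /negPf ->]; rewrite andbF mul0r.
Qed.

End Rotor.

(** * Hitting times bounded below by a potential *)

Section HittingTime.
Variables (R : realType) (V : finType) (e : rel V) (s : V).
Hypothesis deg0 : forall u, (0 < deg e u)%N.

Lemma sum_srw (F : V -> R) u :
  \sum_v srw R e u v * F v = (\sum_(v | e u v) F v) / (deg e u)%:R.
Proof.
rewrite mulr_suml [RHS]big_mkcond; apply: eq_bigr => v _; rewrite /srw.
by case: ifP => _; rewrite ?mul0r // mulrC.
Qed.

Lemma srw_ge0 u v : 0 <= srw R e u v.
Proof. by rewrite /srw; case: ifP => // _; rewrite invr_ge0. Qed.

Lemma sum_srw1 u : \sum_v srw R e u v = 1.
Proof.
under eq_bigr do rewrite -[srw _ _ _ _]mulr1.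
by rewrite sum_srw sum_neighbours mulr1 divff // pnatr_eq0 -lt0n.
Qed.

Lemma first_hit_prob0 u : first_hit_prob R e u s 0 = (u == s)%:R.
Proof.
rewrite /first_hit_prob big_mkcond (big_pred1 [tuple]) /=.
  by rewrite andbT; case: eqP.
by move=> p; rewrite [p]tuple0 /= eqxx.
Qed.

(** First-step decomposition, splitting a trajectory into head and tail. From [u = s] the start
    already lies in [belast], so no trajectory qualifies. *)
Lemma first_hit_probS u t : first_hit_prob R e u s t.+1 =
  if u == s then 0 else \sum_v srw R e u v * first_hit_prob R e v s t.
Proof.
rewrite /first_hit_prob.
rewrite (reindex (fun p : V * t.-tuple V => cons_tuple p.1 p.2)) /=; last first.
  exists (fun p : t.+1.-tuple V => (thead p, [tuple of behead p])) => [[v p]|p] _.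
    by rewrite /= theadE; congr pair; apply: val_inj.
  by rewrite [RHS]tuple_eta; apply: val_inj.
have [->|us] := eqVneq u s.
  by rewrite big1 // => -[v p] /=; rewrite inE eqxx andbF.
under [RHS]eq_bigr do rewrite mulr_sumr.
rewrite pair_big_dep /=; apply: eq_bigl => -[v p] /=.
by rewrite inE [s == u]eq_sym (negPf us).
Qed.

Lemma first_hit_prob_ge0 u t : 0 <= first_hit_prob R e u s t.
Proof.
elim: t u => [|t IH] u; rewrite ?first_hit_prob0 ?first_hit_probS //.
by case: ifP => // _; apply: sumr_ge0 => v _; rewrite mulr_ge0 ?srw_ge0.
Qed.

(* P_u(T_s >= t) *)
Fixpoint survival_prob (t : nat) (u : V) : R :=
  if t is t'.+1 then
    if u == s then 0 else \sum_v srw R e u v * survival_prob t' v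
  else 1.

Lemma survival_prob_ge0 t u : 0 <= survival_prob t u.
Proof.
elim: t u => [|t IH] u //=; case: ifP => // _.
by apply: sumr_ge0 => v _; rewrite mulr_ge0 ?srw_ge0.
Qed.

Lemma survival_probB t u :
  survival_prob t u - survival_prob t.+1 u = first_hit_prob R e u s t.
Proof.
elim: t u => [|t IH] u.
  rewrite first_hit_prob0 /=; case: eqP => _; rewrite ?subr0 //.
  by under eq_bigr do rewrite mulr1; rewrite sum_srw1 subrr.
rewrite first_hit_probS; under [in RHS]eq_bigr do rewrite -IH mulrBr.
by rewrite sumrB /=; case: eqP => // _; rewrite subrr.
Qed.

Lemma survival_prob_nincr t t' u :
  (t <= t')%N -> survival_prob t' u <= survival_prob t u.
Proof.
move=> /subnKC <-; elim: (t' - t)%N => [|k IH]; first by rewrite addn0.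
rewrite addnS; apply: le_trans IH.
by rewrite -subr_ge0 survival_probB first_hit_prob_ge0.
Qed.

Lemma sum_first_hit_prob t u :
  \sum_(0 <= k < t) first_hit_prob R e u s k = 1 - survival_prob t u.
Proof.
elim: t => [|t IH]; first by rewrite big_geq //= subrr.
by rewrite big_nat_recr //= IH -survival_probB /= subrKA.
Qed.

(** The left side is the mean of the minimum of [T_s] and [n], which is at most [T_s] on [T_s < m]
    and at most [n] elsewhere. *)
Lemma sum_survival_prob_le n m u : (n <= m)%N ->
  \sum_(1 <= k < n.+1) survival_prob k u <=
  \sum_(0 <= t < m) t%:R * first_hit_prob R e u s t + n%:R * survival_prob m u.
Proof.
move=> /subnKC <-; elim: (m - n)%N => [|k IH]; last first.
  rewrite addnS [in leRHS]big_nat_recr //=; apply: le_trans IH _.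
  have := survival_probB (n + k) u; have := first_hit_prob_ge0 u (n + k).
  set p := first_hit_prob _ _ _ _ _; set q' := survival_prob _.+1 u => p0 pE.
  have -> : survival_prob (n + k) u = p + q' by rewrite -pE subrK.
  rewrite mulrDr -addrA lerD2l lerD2r.
  by rewrite ler_wpM2r // ler_nat leq_addr.
rewrite addn0; elim: n => [|n IH]; first by rewrite !big_geq // mul0r addr0.
rewrite big_nat_recr //= [in leRHS]big_nat_recr //=.
rewrite -survival_probB -natr1; move: IH.
set q := survival_prob n u; set q' := survival_prob n.+1 u.
set a := \sum_(_ <= _ < _) _; set b := \sum_(_ <= _ < _) _ => IH.
have -> : b + n%:R * (q - q') + (n%:R + 1) * q' = b + n%:R * q + q' by ring.
by rewrite lerD2r.
Qed.

(* Optional stopping at time min(T_s, n): g loses at most c per step in mean. *)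
Lemma potential_le_survival (g : V -> R) (c M : R) n u :
  g s = 0 -> 0 <= c -> (forall v, g v <= M) ->
  (forall u, u != s -> laplacian e g u <= c * (deg e u)%:R) ->
  g u <= c * (\sum_(1 <= k < n.+1) survival_prob k u) + M * survival_prob n u.
Proof.
move=> gs0 c0 gM Lg.
have M0 : 0 <= M by rewrite -gs0.
elim: n u => [|n IH] u; first by rewrite big_geq // mulr0 add0r mulr1.
have [->|us] := eqVneq u s.
  rewrite gs0 addr_ge0 ?mulr_ge0 ?survival_prob_ge0 //.
  by apply: sumr_ge0 => k _; exact: survival_prob_ge0.
have d0 : 0 < (deg e u)%:R :> R by rewrite ltr0n.
(* The Laplacian bound divided by the degree: one step of the walk lowers [g] by at most [c] on
   average. *)
have gu : g u <= c + \sum_v srw R e u v * g v.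
  rewrite sum_srw -(ler_pM2r d0) mulrDl divfK ?gt_eqF //.
  rewrite -lerBlDr; apply: le_trans (Lg u us).
  by rewrite /laplacian sumrB sum_neighbours mulrC.
apply: le_trans gu _.
have le : \sum_v srw R e u v * g v <=
   \sum_v srw R e u v * (c * (\sum_(1 <= k < n.+1) survival_prob k v)
                         + M * survival_prob n v).
  by apply: ler_sum => v _; rewrite ler_wpM2l ?srw_ge0.
apply: (@le_trans _ _ (c + _)); first by rewrite lerD2l; exact: le.
have sE k : survival_prob k.+1 u = \sum_v srw R e u v * survival_prob k v.
  by rewrite /= (negPf us).
have s1 : survival_prob 1 u = 1.
  by rewrite sE; under eq_bigr do rewrite mulr1; rewrite sum_srw1.
rewrite big_nat_recl // s1 mulrDr mulr1 -addrA lerD2l.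
under [leLHS]eq_bigr do rewrite mulrDr mulrCA [X in _ + X]mulrCA.
rewrite big_split -!mulr_sumr -sE lerD2r ler_wpM2l //.
under [leLHS]eq_bigr do rewrite mulr_sumr.
rewrite exchange_big; apply: ler_sum => k _.
by rewrite sE.
Qed.

Lemma nneseries_le (p : nat -> R) (c : R) : (forall t, 0 <= p t) ->
  (forall n, \sum_(0 <= t < n) p t <= c) -> (\sum_(0 <= t <oo) (p t)%:E <= c%:E)%E.
Proof.
move=> p0 pc; apply: lime_le.
  by apply: is_cvg_nneseries => n _ _; rewrite lee_fin.
by apply: nearW => n; rewrite sumEFin lee_fin.
Qed.

Lemma nneseries_ge (p : nat -> R) n : (forall t, 0 <= p t) ->
  ((\sum_(0 <= t < n) p t)%:E <= \sum_(0 <= t <oo) (p t)%:E)%E.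
Proof.
move=> p0; rewrite -sumEFin; apply: nneseries_lim_ge => k _ _; by rewrite lee_fin.
Qed.

(** This is the limit of [potential_le_survival] as [n] grows: the survival term vanishes when [s]
    is hit almost surely, and otherwise the hitting time is infinite. *)
Lemma hitting_time_ge_potential (g : V -> R) (c : R) u :
  g s = 0 -> 0 < c ->
  (forall u, u != s -> laplacian e g u <= c * (deg e u)%:R) ->
  ((c^-1 * g u)%:E <= hitting_time R e u s)%E.
Proof.
move=> gs0 c0 Lg; rewrite /hitting_time.
set p := first_hit_prob R e u s.
have p0 t : 0 <= p t by exact: first_hit_prob_ge0.
have tp0 t : 0 <= t%:R * p t by rewrite mulr_ge0.
set S := (\sum_(0 <= t <oo) (p t)%:E)%E.
set L := (\sum_(0 <= t <oo) (t%:R * p t)%:E)%E.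
have L0 : (0 <= L)%E by apply: nneseries_ge0 => t _ _; rewrite lee_fin.
have S1 : (S <= 1)%E.
  apply: nneseries_le => // n; rewrite sum_first_hit_prob.
  by rewrite lerBlDr lerDl survival_prob_ge0.
have S0 : (0 <= S)%E by apply: nneseries_ge0 => t _ _; rewrite lee_fin.
have Sfin : S \is a fin_num.
  by rewrite ge0_fin_numE //; apply: le_lt_trans S1 (ltry _).
move: S1; rewrite le_eqVlt => /orP [/eqP SE|S1]; last first.
  rewrite gt0_mulye ?sube_gt0 // addey ?leey //.
  by rewrite gt_eqF // (lt_le_trans (ltNyr 0)).
rewrite SE subee // mule0 adde0.
pose M : R := \sum_v `|g v|.
have gM v : g v <= M.
  by apply: le_trans (ler_norm _) _; rewrite /M (bigD1 v) //= lerDl sumr_ge0.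
(* Otherwise the partial sums, equal to 1 minus a survival probability, would stay below [1 - eps]
   and contradict [S = 1]. *)
have small (eps : R) : 0 < eps -> exists n, survival_prob n u < eps.
  move=> eps0; apply: contrapT => H.
  suff : (S <= (1 - eps)%:E)%E.
    by rewrite SE lee_fin lerBrDr gerDl leNgt eps0.
  apply: nneseries_le => // n; rewrite sum_first_hit_prob lerD2l lerN2 leNgt.
  by apply/negP => Hn; apply: H; exists n.
have M0 : 0 <= M by rewrite -gs0.
apply/lee_addgt0Pr => eps eps0.
(* First [n] makes [M / c * survival_prob n u] at most [eps / 2]; then [m], depending on [n], does
   the same for [n%:R * survival_prob m u]. The added 1 keeps the divisors positive. *)
have e20 : 0 < eps / 2 by rewrite divr_gt0.
have M10 : 0 < M / c + 1 by rewrite ltr_wpDl // divr_ge0 // ltW.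
have [n qn] := small _ (divr_gt0 e20 M10).
have n10 : 0 < n%:R + 1 :> R by rewrite natr1.
have [m' qm'] := small _ (divr_gt0 e20 n10).
pose m := maxn n m'.
have qm : survival_prob m u < eps / 2 / (n%:R + 1).
  by apply: le_lt_trans qm'; apply: survival_prob_nincr; rewrite leq_maxr.
have nm : (n <= m)%N by rewrite leq_maxl.
apply: (@le_trans _ _ ((\sum_(0 <= t < m) t%:R * p t)%:E + eps%:E)%E); last first.
  by rewrite leeD2r // nneseries_ge.
rewrite -EFinD lee_fin mulrC ler_pdivrMr //.
have := sum_survival_prob_le u nm.
have := potential_le_survival n u gs0 (ltW c0) gM Lg.
rewrite -/p; set A := \sum_(_ <= _ < _) _ => gA.
set B := \sum_(_ <= _ < _) _ => AB.
have h1 : M / c * survival_prob n u <= eps / 2.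
  rewrite ltr_pdivlMr // in qn; apply: le_trans (ltW qn).
  by rewrite mulrC ler_wpM2l ?survival_prob_ge0 // lerDl.
have h2 : n%:R * survival_prob m u <= eps / 2.
  rewrite ltr_pdivlMr // in qm; apply: le_trans (ltW qm).
  by rewrite mulrC ler_wpM2l ?survival_prob_ge0 // lerDl.
have -> : g u = (g u / c) * c by rewrite divfK ?gt_eqF.
rewrite ler_pM2r //.
have : g u / c <= A + M / c * survival_prob n u.
  rewrite ler_pdivrMr // mulrDl mulrAC divfK ?gt_eqF //.
  by rewrite [A * c]mulrC.
lra.
Qed.

End HittingTime.

(** * Combining flow, rotor and hitting time bounds *)

Lemma sum_visits_div_deg_le (R : realType) (V : finType) (e : rel V) d rho pos x
    (g : V -> R) s t :
  symmetric e -> rotor_lengths e d -> rotor_sequences e d rho ->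
  rotor_positions d pos ->
  (forall u, laplacian e g u = if u == s then - (#|V|.-1)%:R else 1) ->
  let w := rotor_walk rho pos x in
  \sum_u (visits w t u)%:R / (deg e u)%:R <=
    #|V|%:R * ((visits w t s)%:R / (deg e s)%:R) + (g (w 0%N) - g (w t))
    + 2 * (kappa e d)%:R * edge_sum e (fun i j => `|g j - g i|).
Proof.
move=> esym dlen rhoP posP Lg /=; set w := rotor_walk rho pos x.
pose y u : R := (visits w t u)%:R / (deg e u)%:R.
have V0 : (0 < #|V|)%N by apply/card_gt0P; exists s.
have -> : \sum_u (visits w t u)%:R / (deg e u)%:R =
    \sum_u y u * laplacian e g u + #|V|%:R * y s.
  rewrite (bigD1 s) //= [in RHS](bigD1 s) //= Lg eqxx -/(y s).
  have -> : #|V|%:R = #|V|.-1%:R + 1 :> R by rewrite natr1 prednK.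
  rewrite [X in _ = _ + X + _](eq_bigr y); first by rewrite -/(y s); ring.
  by move=> u /negPf us; rewrite Lg us mulr1.
rewrite addrC -addrA lerD2l.
(* Split [y u] into the crossing count, whose sum telescopes, and an error bounded by
   [kappa e d]. *)
have -> : \sum_u y u * laplacian e g u =
    \sum_u \sum_(v | e u v) (crossings w t u v)%:R * (g u - g v) +
    \sum_u \sum_(v | e u v) (y u - (crossings w t u v)%:R) * (g u - g v).
  rewrite -big_split; apply: eq_bigr => u _; rewrite -big_split mulr_sumr.
  by apply: eq_bigr => v _; rewrite /=; ring.
rewrite (sum_crossings x dlen rhoP posP) lerD2l.
rewrite /edge_sum [2 * _]mulrC -!mulrA mulVKf ?pnatr_eq0 // mulr_sumr.
apply: ler_sum => u _; rewrite mulr_sumr; apply: ler_sum => v euv.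
apply: le_trans (ler_norm _) _; rewrite normrM [in leRHS]distrC.
by rewrite ler_wpM2r // rotor_discrepancy.
Qed.

Lemma uncovered_time_le (R : realType) (V : finType) (e : rel V) d rho pos x
    (f : V -> V -> V -> R) (H : R) t :
  connected_simple_graph e -> rotor_lengths e d ->
  (forall s, optimal_source_flow e s (f s)) ->
  (max_hitting_time R e <= H%:E)%E ->
  rotor_sequences e d rho -> rotor_positions d pos ->
  ~ edges_covered e (rotor_walk rho pos x) t ->
  t%:R <= (max_degree e)%:R * (H / (min_degree e)%:R
    + #|V|%:R * (kappa e d)%:R + 2 * (kappa e d)%:R * max_flow_norm1 e f).
Proof.
move=> [esym _ V0 econn] dlen fopt HH rhoP posP uncov.
set w := rotor_walk rho pos x in uncov *.
have deg0 u : (0 < deg e u)%N by apply: rotor_lengths_deg_gt0 dlen.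
(* The source [s] is the tail of an untraversed edge; it depends on the walk and on [t], hence the
   maximum over sources in the bound. *)
have [s [j [esj c0]]] : exists s j, e s j /\ crossings w t s j = 0%N.
  apply: contrapT => nex; apply: uncov => i j eij.
  have : crossings w t i j != 0%N.
    by apply/eqP => c0; apply: nex; exists i, j.
  rewrite sum_nat_eq0 negb_forall => /existsP [k] /=.
  by case: andP => // -[/eqP wi /eqP wj] _; exists k => //; left.
have [g [gs0 Lg]] := source_potential_exists R esym s econn.
have Lg1 u : u != s -> laplacian e g u = 1 by move=> /negPf us; rewrite Lg us.
have g0 u : 0 <= g u.
  by apply: (@source_potential_ge0 _ _ e _ s) => // v /Lg1 ->.
have md0 : 0 < (min_degree e)%:R :> R by rewrite ltr0n min_degree_gt0.
have gH u : g u <= H / (min_degree e)%:R.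
  (* The drift constant is [1 / min_degree e], since the Laplacian is 1 off [s] and every degree is
     at least [min_degree e]. *)
  have Lc v : v != s -> laplacian e g v <= (min_degree e)%:R^-1 * (deg e v)%:R.
    by move=> /Lg1 ->; rewrite mulrC ler_pdivlMr // mul1r ler_nat min_degree_le_deg.
  have ic0 : 0 < (min_degree e)%:R^-1 :> R by rewrite invr_gt0.
  have := hitting_time_ge_potential deg0 u gs0 ic0 Lc.
  rewrite invrK ler_pdivlMr // mulrC -lee_fin => /le_trans; apply.
  apply: le_trans HH; rewrite /max_hitting_time.
  apply: le_trans (le_bigmax _ _ u).
  exact: (le_bigmax _ (fun v => hitting_time R e u v)).
have xs : (visits w t s)%:R / (deg e s)%:R <= (kappa e d)%:R :> R.
  have := rotor_discrepancy x dlen rhoP posP R t esj.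
  by rewrite -/w c0 subr0; apply: le_trans; exact: ler_norm.
have fle : edge_sum e (fun i j => `|g j - g i|) <= max_flow_norm1 e f.
  rewrite (_ : edge_sum _ _ = edge_sum e (fun i j => `|f s i j|)).
    exact: (le_bigmax _ (fun s => edge_sum e (fun i j => `|f s i j|))).
  rewrite /edge_sum; congr (_ * _); apply: eq_bigr => u _.
  by apply: eq_bigr => v euv; rewrite (optimal_source_flowE esym (fopt s) Lg).
have tle : t%:R <= (max_degree e)%:R * \sum_u (visits w t u)%:R / (deg e u)%:R :> R.
  rewrite -{1}(sum_visits w t) natr_sum mulr_sumr; apply: ler_sum => u _.
  by rewrite mulrA ler_pdivlMr ?ltr0n // mulrC ler_wpM2r // ler_nat deg_le_max_degree.
apply: le_trans tle _; rewrite ler_wpM2l //.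
apply: le_trans (sum_visits_div_deg_le x t esym dlen rhoP posP Lg) _.
rewrite -/w; apply: lerD; last by rewrite ler_wpM2l // mulr_ge0.
rewrite [leRHS]addrC; apply: lerD; first by rewrite ler_wpM2l.
by apply: le_trans (gH (w 0%N)); rewrite gerBl.
Qed.

Theorem theorem3p13 (R : realType) :
  exists C : R,
  forall (V : finType) (e : rel V) (d : V -> nat) (f : V -> V -> V -> R),
  connected_simple_graph e ->
  rotor_lengths e d ->
  (forall s : V, optimal_source_flow e s (f s)) ->
  (rotor_edge_cover_time e R d <=
   C%:E * (((max_degree e)%:R / (min_degree e)%:R)%:E * max_hitting_time R e
           + ((max_degree e)%:R * #|V|%:R * (kappa e d)%:R)%:E
           + ((kappa e d)%:R * (max_degree e)%:R * max_flow_norm1 e f)%:E))%E.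
Proof.
(* The factor 2 is needed by the flow term of [B]; it also lets the second term, which is at least
   1, absorb the rounding of [B] to an integer time. *)
exists 2 => V e d f graph dlen fopt.
have [_ _ V0 _] := graph; have /card_gt0P [v _] := V0.
have deg0 u : (0 < deg e u)%N by apply: rotor_lengths_deg_gt0 dlen.
have min0 : (0 < min_degree e)%N by exact: min_degree_gt0.
have Md0 : (0 < max_degree e)%N := leq_trans (deg0 v) (deg_le_max_degree e v).
have kappa0 : (0 < kappa e d)%N.
  have [dv0 dvd] := dlen v; apply: leq_trans (leq_bigmax v) => /=.
  by rewrite divn_gt0 // dvdn_leq.
(* The zero potential gives nonnegativity, which rules out the default value [-oo] of the
   maximum. *)
have H0 : (0 <= max_hitting_time R e)%E.
  have := @hitting_time_ge_potential R V e v deg0 (fun=> 0) 1 v erefl ltr01.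
  rewrite mulr0 => Hv; apply: le_trans (Hv _) _.
    move=> u _; rewrite /laplacian big1 ?mulr_ge0 // => ? _; exact: subrr.
  apply: le_trans (le_bigmax _ _ v).
  exact: (le_bigmax _ (fun u => hitting_time R e v u)).
have F0 : 0 <= max_flow_norm1 e f by exact: bigmax_ge_id.
apply: ge_ereal_sup => c [x [rho [pos [rhoP posP ->]]]].
case HE: (max_hitting_time R e) H0 => [H| |] H0; last by [].
  (* An infinite hitting time has a positive coefficient, so the right side is [+oo]. *)
  2: rewrite gt0_muley ?lte_fin ?divr_gt0 ?ltr0n // !addye //.
  2: by rewrite gt0_muley ?lte_fin // leey.
rewrite lee_fin in H0.
have HH : (max_hitting_time R e <= H%:E)%E by rewrite HE.
have bound t := @uncovered_time_le R V e d rho pos x f H t graph dlen fopt HH rhoP posP.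
set B := (max_degree e)%:R * _ in bound.
rewrite -EFinM.
(* This is the first integer above [B]; an untraversed edge at that time would contradict
   [bound]. *)
apply: ge_ereal_inf; exists ((Num.truncn B).+1%:R)%:E.
  exists (Num.truncn B).+1 => //; apply: contrapT => /bound.
  by rewrite leNgt truncnS_gt.
have B0 : 0 <= B by rewrite mulr_ge0 // !addr_ge0 ?mulr_ge0 ?divr_ge0 // ltW.
rewrite lee_fin -natr1.
have tB : (Num.truncn B)%:R <= B by rewrite truncn_le.
have a1 : 1 <= (max_degree e)%:R * #|V|%:R * (kappa e d)%:R :> R.
  by rewrite -!natrM ler1n !muln_gt0 Md0 V0.
have a2 : 0 <= (max_degree e)%:R / (min_degree e)%:R * H by rewrite mulr_ge0 // divr_ge0.
apply: (@le_trans _ _ (B + 1)); first by rewrite lerD2r.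
rewrite /B.
have -> : (max_degree e)%:R * (H / (min_degree e)%:R + #|V|%:R * (kappa e d)%:R
     + 2 * (kappa e d)%:R * max_flow_norm1 e f) =
  (max_degree e)%:R / (min_degree e)%:R * H
  + (max_degree e)%:R * #|V|%:R * (kappa e d)%:R
  + 2 * ((kappa e d)%:R * (max_degree e)%:R * max_flow_norm1 e f) by ring.
lra.
Qed.
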